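(* Fix a finite set $\Lambda$, an integer $d\geq1$, polynomials $P_1,\dots,P_k\in\mathbb{R}[x_1,\dots,x_d,y_1,\dots,y_d]$, a function $\phi:\{+,-,0\}^k\to\Lambda$, and a non-empty open subset $U\subseteq\mathbb{R}^d$ which is definable by polynomials. Suppose that for any two distinct points $a,a'\in U$ there exists $b\in U$ with $P_s(a,b)\neq0$ and $P_s(a',b)\neq0$ for all $1\le s\le k$ and $$\phi(\operatorname{sgn}P_1(a,b),\dots,\operatorname{sgn}P_k(a,b))\neq\phi(\operatorname{sgn}P_1(a',b),\dots,\operatorname{sgn}P_k(a',b)).$$ Then there are at least $n^{(1-o(1))dn}$ strongly $(P_1,\dots,P_k,\phi,U,\Lambda)$-representable edge-labelings of the complete graph on the vertex set $\{1,\dots,n\}$, where the $o(1)$ term tends to $0$ as $n\to\infty$.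
   Context: For a real number $x$, $\operatorname{sgn}(x)\in\{+,-,0\}$ is its sign (with $\operatorname{sgn}(0)=0$). An edge-labeling of a graph $G$ with labels in $\Lambda$ is a function $E(G)\to\Lambda$. For points $a_1,\dots,a_n\in U$, $F_{P_1,\dots,P_k,\phi}(a_1,\dots,a_n)$ is the edge-labeling of the complete graph on $\{1,\dots,n\}$ in which, for $1\le i<j\le n$, the edge $ij$ gets the label $\phi(\operatorname{sgn}P_1(a_i,a_j),\dots,\operatorname{sgn}P_k(a_i,a_j))$; here $P_s(a,b)$ denotes evaluation at $(a,b)\in\mathbb{R}^{2d}$. An edge-labeling of the complete graph on $\{1,\dots,n\}$ is strongly $(P_1,\dots,P_k,\phi,U,\Lambda)$-representable if it equals $F_{P_1,\dots,P_k,\phi}(a_1,\dots,a_n)$ for some $a_1,\dots,a_n\in U$ such that $P_s(a_i,a_j)\neq0$ for all $1\le i<j\le n$ and all $1\le s\le k$. A subset $U\subseteq\mathbb{R}^d$ is definable by polynomials if there are real polynomials $Q_1,\dots,Q_\ell$ in $d$ variables and a set $S\subseteq\{+,-,0\}^\ell$ with $U=\{x\in\mathbb{R}^d:(\operatorname{sgn}Q_1(x),\dots,\operatorname{sgn}Q_\ell(x))\in S\}$. *)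

(* Defs.v *)
From Stdlib Require Import Reals.
From mathcomp Require Import all_boot.
Set Implicit Arguments. Unset Strict Implicit. Unset Printing Implicit Defensive.

(* Signs {+,-,0}:  Some true = +,  Some false = -,  None = 0. *)
Notation sign := (option bool).
Definition sgn (x : R) : sign :=
  match Rcase_abs x with
  | left _ => Some false
  | right _ => if Req_EM_T x 0 then None else Some true
  end.

(* Real polynomials in m variables x_0..x_{m-1}: finite lists of
   (coefficient, exponent vector) pairs, i.e. sums of monomials. *)
Definition mpoly (m : nat) := seq (R * ('I_m -> nat)).

Definition monom_eval (m : nat) (e : 'I_m -> nat) (x : 'I_m -> R) : R :=
  foldr (fun i acc => Rmult (pow (x i) (e i)) acc) R1 (enum 'I_m).

Definition mpoly_eval (m : nat) (p : mpoly m) (x : 'I_m -> R) : R :=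
  foldr (fun t acc => Rplus (Rmult t.1 (monom_eval t.2 x)) acc) R0 p.

Definition point (d : nat) := 'I_d -> R.

Definition pair_pt (d : nat) (a b : point d) : 'I_(d + d) -> R :=
  fun i => match split i with inl j => a j | inr j => b j end.

Definition eval2 (d : nat) (P : mpoly (d + d)) (a b : point d) : R :=
  mpoly_eval P (pair_pt a b).

Definition lab (d k : nat) (L : finType) (P : 'I_k -> mpoly (d + d))
  (phi : {ffun 'I_k -> sign} -> L) (a b : point d) : L :=
  phi [ffun s => sgn (eval2 (P s) a b)].

(* U subset of R^d is open (sup-norm balls generate the usual topology). *)
Definition is_open (d : nat) (U : point d -> Prop) : Prop :=
  forall x, U x -> exists eps : R, Rlt R0 eps /\
    forall y : point d, (forall i, Rlt (Rabs (Rminus (y i) (x i))) eps) -> U y.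

Definition definable_by_polys (d : nat) (U : point d -> Prop) : Prop :=
  exists (l : nat) (Q : 'I_l -> mpoly d) (S : {ffun 'I_l -> sign} -> Prop),
    forall x, U x <-> S [ffun j => sgn (mpoly_eval (Q j) x)].

Definition edge (n : nat) := {ij : 'I_n * 'I_n | ij.1 < ij.2}.

Definition labeling (n : nat) (L : finType) := {ffun edge n -> L}.

Definition F_lab (d k n : nat) (L : finType) (P : 'I_k -> mpoly (d + d))
  (phi : {ffun 'I_k -> sign} -> L) (a : 'I_n -> point d) : labeling n L :=
  [ffun e : edge n => lab P phi (a (val e).1) (a (val e).2)].

Definition strongly_representable (d k n : nat) (L : finType)
  (P : 'I_k -> mpoly (d + d)) (phi : {ffun 'I_k -> sign} -> L)
  (U : point d -> Prop) (c : labeling n L) : Prop :=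
  exists a : 'I_n -> point d,
    (forall i, U (a i)) /\
    (forall (i j : 'I_n) (s : 'I_k), i < j -> eval2 (P s) (a i) (a j) <> R0) /\
    c = F_lab P phi a.

(* Main.v *)
(** Idea. Suppose finitely many test points [B j] and many points [x q] of [U] are given such that
    any two [x q] have different labels towards some [B j]. Placing [n - m] vertices freely at the
    [x q] and the remaining [m] at the test points gives (number of [x q])^(n - m) labelings, and a
    small generic perturbation makes all polynomials nonzero without changing the relevant signs.
    So it suffices to find [m = O(Q)] test points with [Q^d] separated points [x q].

    Fix a cube in [U]. By compactness there are finitely many points [b] such that any two far
    apart points of the cube are given different labels by a whole neighbourhood of some [b]. Run a
    polynomial curve through all these [b] and take many test points on it close to each [b].
    Since [P_s(a, -)] is nonzero at one of the [b], it has boundedly many zeros on the curve: each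
    [a] lies on at most [J] of the surfaces [P_s(-, B j) = 0], with [J] independent of [Q]. Hence
    the pseudometric "number of [j] labelling [a] and [a'] differently" jumps by at most [J] and is
    at least a constant times [Q] between opposite faces of the cube. The distances to [d] faces
    of the cube, one in each direction, are thus coarsely continuous, and a Sperner-type lemma
    (a discrete Poincare-Miranda theorem) shows that they take, up to [J], all prescribed values;
    prescribing [Q^d] well-spaced tuples of values yields the [x q]. *)

Require Import Defs.
From Stdlib Require Import Reals Lra ClassicalEpsilon FunctionalExtensionality.
From mathcomp Require Import all_boot all_algebra.
From mathcomp Require Import Rstruct zify.
Set Implicit Arguments. Unset Strict Implicit. Unset Printing Implicit Defensive.
Import GRing.Theory.

(** * A cubical Sperner lemma *)

Section CubicalCup.
Local Open Scope ring_scope.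
Variable d : nat.
Implicit Types (x y : {ffun 'I_d -> nat}) (A B : {set 'I_d}) (i j : 'I_d).
Implicit Types (r : seq 'I_d) (F G : {ffun 'I_d -> nat} -> bool).

Definition shift x A : {ffun 'I_d -> nat} := [ffun i => (x i + (i \in A))%N].
Definition upd x i t : {ffun 'I_d -> nat} := [ffun j => if j == i then t else x j].

Lemma shift_notin x A i : i \notin A -> shift x A i = x i.
Proof. by rewrite ffunE => /negbTE ->; rewrite addn0. Qed.

Lemma upd_same x i t : upd x i t i = t.
Proof. by rewrite ffunE eqxx. Qed.

(** Here [bool] serves as the field with two elements, xor being the addition. *)
Lemma addb2 (b : bool) : b + b = 0. Proof. by case: b. Qed.

Lemma shiftD1 x A i : i \in A -> shift (shift x [set i]) (A :\ i) = shift x A.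
Proof.
move=> iA; apply/ffunP => j; rewrite !ffunE -addnA !inE; congr (_ + _)%N.
by case: (j =P i) => [->|_] //; rewrite iA.
Qed.

(** The ordered pairs (i, j) and (j, i) cancel mod 2. *)
Lemma sum_sym_bool A (g : 'I_d -> 'I_d -> bool) : (forall i j, g i j = g j i) ->
  \sum_(i in A) \sum_(j in A :\ i) g i j = 0.
Proof.
move=> gC.
have -> : \sum_(i in A) \sum_(j in A :\ i) g i j =
   \sum_(i in A) \sum_(j in A | (i < j)%N) g i j + \sum_(i in A) \sum_(j in A | (j < i)%N) g i j.
  rewrite -big_split; apply: eq_bigr => i iA /=.
  rewrite (bigID (fun j : 'I_d => (i < j)%N)) /=; congr (_ + _);
    apply: eq_bigl => j; rewrite !inE -val_eqE /=.
    by case: (ltngtP j i) => //=; rewrite ?andbF ?andbT.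
  by case: (ltngtP j i) => //=; rewrite ?andbF ?andbT.
rewrite [X in _ + X](exchange_big_dep (mem A)) //=; last by move=> i j _ /andP[].
rewrite [X in _ + X](_ : _ = \sum_(i in A) \sum_(j in A | (i < j)%N) g i j) ?addb2 //.
by apply: eq_bigr => i iA; apply: eq_big => [j|j _]; rewrite ?iA // gC.
Qed.

Variable s : 'I_d -> {ffun 'I_d -> nat} -> bool.

(* The mod 2 cubical cup product of the coboundaries of the [s i], [i] in [r] (the head of [r]
   being the last factor), evaluated on the face with corner [x] and directions [A]. *)
Fixpoint cup r x A : bool :=
  if r is k :: r' then
    \sum_(i in A) cup r' x (A :\ i) * (s k (shift x A) + s k (shift x (A :\ i)))
  else 1.

(** A cup product of coboundaries is a cocycle: its values on all facets of a face cancel mod 2,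
    written here as upper facets against lower facets. *)
Lemma cup_closed r x A :
  \sum_(i in A) cup r (shift x [set i]) (A :\ i) = \sum_(i in A) cup r x (A :\ i).
Proof.
elim: r x A => [//|k r IH] x A /=.
pose w i j := cup r x (A :\ i :\ j).
have wC i j : w i j = w j i by rewrite /w !setDDl setUC.
(* After exchanging the sums, the induction hypothesis on the directions [A :\ j] turns upper facets
   into lower ones. *)
transitivity (\sum_(j in A) \sum_(i in A :\ j) w j i * (s k (shift x A) + s k (shift x (A :\ j)))).
  transitivity (\sum_(i in A) \sum_(j in A :\ i) cup r (shift x [set i]) (A :\ j :\ i)
       * (s k (shift x A) + s k (shift x (A :\ j)))).
    apply: eq_bigr => i iA; apply: eq_bigr => j; rewrite !inE => /andP[ji jA].
    rewrite shiftD1 // !setDDl setUC -!setDDl shiftD1 //.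
    by rewrite !inE iA andbT eq_sym.
  rewrite (exchange_big_dep (mem A)) /=; last by move=> i j _; rewrite !inE => /andP[].
  apply: eq_bigr => j jA; rewrite -mulr_suml -[RHS]mulr_suml /w -IH; congr (_ * _).
  by apply: eq_bigl => i; rewrite !inE jA andbT eq_sym andbC.
apply/eqP; rewrite -subr_eq0 -sumrB; apply/eqP.
(* What remains reduces to a sum symmetric in [i] and [j]: [w i j] times the total of [s k] over the
   four corners involved. *)
rewrite -[RHS](@sum_sym_bool A (fun i j => w i j * (s k (shift x A) + s k (shift x (A :\ i))
   + (s k (shift x (A :\ j)) + s k (shift x (A :\ i :\ j)))))); last first.
  move=> i j; rewrite wC; congr (_ * _); rewrite !setDDl (setUC [set j]).
  by do 4! case: (s k _).
transitivity (\sum_(i in A) \sum_(j in A :\ i) w i j * (s k (shift x A) + s k (shift x (A :\ i)))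
  - \sum_(i in A) \sum_(j in A :\ i) w i j * (s k (shift x (A :\ i)) + s k (shift x (A :\ i :\ j)))).
  by rewrite -sumrB.
have -> : \sum_(i in A) \sum_(j in A :\ i) w i j * (s k (shift x (A :\ i)) + s k (shift x (A :\ i :\ j)))
  = \sum_(i in A) \sum_(j in A :\ i) w i j * (s k (shift x (A :\ j)) + s k (shift x (A :\ i :\ j))).
  rewrite (exchange_big_dep (mem A)) /=; last by move=> i j _; rewrite !inE => /andP[].
  apply: eq_bigr => j jA; apply: eq_big => [i|i _].
    by rewrite !inE jA andbT eq_sym andbC.
  by rewrite wC !setDDl (setUC [set j]).
rewrite -sumrB; apply: eq_bigr => i _; rewrite -sumrB; apply: eq_bigr => j _.
by rewrite -mulrBr; congr (_ * _); do 4! case: (s k _).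
Qed.

(** A function constant on the vertices of a face has zero coboundary there, which kills the factor
    belonging to [i]. *)
Lemma cup_eq0 r x A i (v : bool) : i \in r ->
  (forall B, B \subset A -> s i (shift x B) = v) -> cup r x A = 0.
Proof.
elim: r A => [//|k r IH] A; rewrite inE => ir sv /=.
apply: big1 => j jA; case/orP: ir => [/eqP <-|ir].
  by rewrite !sv ?addb2 ?mulr0 // subD1set.
by rewrite IH ?mul0r // => B BA; apply: sv; apply: subset_trans BA (subD1set _ _).
Qed.

(** As [cup r] is a cocycle, its product with the coboundary of [s k] is the coboundary of the
    product of [cup r] and [s k]. *)
Lemma cup_cons_coboundary k r x A :
  cup (k :: r) x A = \sum_(i in A)
    (cup r (shift x [set i]) (A :\ i) * s k (shift (shift x [set i]) (A :\ i))
     + cup r x (A :\ i) * s k (shift x (A :\ i))).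
Proof.
rewrite big_split /=.
rewrite [X in _ = X + _](eq_bigr (fun i => cup r (shift x [set i]) (A :\ i) * s k (shift x A))); last first.
  by move=> i iA; rewrite shiftD1.
rewrite -mulr_suml cup_closed mulr_suml -big_split /=.
by apply: eq_bigr => i iA; rewrite mulrDr.
Qed.

Variable M : nat.

Fixpoint box_sum r F x : bool :=
  if r is k :: r' then \sum_(t < M) box_sum r' F (upd x k t) else F x.

Lemma eq_box_sum r F G x : F =1 G -> box_sum r F x = box_sum r G x.
Proof. by move=> FG; elim: r x => [|k r IH] x //=; apply: eq_bigr => t _. Qed.

Lemma box_sumD r F G x : box_sum r (fun y => F y + G y) x = box_sum r F x + box_sum r G x.
Proof. by elim: r x => [|k r IH] x //=; rewrite -big_split; apply: eq_bigr => t _. Qed.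

Lemma box_sum0 r x : box_sum r (fun=> 0) x = 0.
Proof. by elim: r x => [|k r IH] x //=; apply: big1. Qed.

Lemma box_sum_big r I (e : seq I) (P : pred I) (F : I -> {ffun 'I_d -> nat} -> bool) x :
  box_sum r (fun y => \sum_(i <- e | P i) F i y) x = \sum_(i <- e | P i) box_sum r (F i) x.
Proof.
elim: r x => [|k r IH] x //=; rewrite exchange_big /=.
by apply: eq_bigr => t _; rewrite IH.
Qed.

Lemma updC x i j t u : i != j -> upd (upd x i t) j u = upd (upd x j u) i t.
Proof.
move=> ij; apply/ffunP => l; rewrite !ffunE.
by case: (l =P j) => // ->; rewrite eq_sym (negbTE ij).
Qed.

Lemma box_sum_upd r F x k t : k \notin r ->
  box_sum r F (upd x k t) = box_sum r (fun y => F (upd y k t)) x.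
Proof.
elim: r x => [|l r IH] x //=; rewrite inE negb_or => /andP[kl kr].
by apply: eq_bigr => u _; rewrite updC // IH.
Qed.

Lemma box_sum_shift r F x k t : k \notin r ->
  box_sum r (fun y => F (shift y [set k])) (upd x k t) = box_sum r F (upd x k t.+1).
Proof.
move=> kr; rewrite !box_sum_upd //; apply: eq_box_sum => y; congr F.
by apply/ffunP => j; rewrite !ffunE inE; case: eqP => _; rewrite ?addn1 ?addn0.
Qed.

Lemma box_sum_telescope k r F x : k \notin r ->
  box_sum (k :: r) (fun y => F (shift y [set k]) + F y) x
   = box_sum r F (upd x k M) + box_sum r F (upd x k 0).
Proof.
move=> kr /=.
under eq_bigr => t _ do rewrite box_sumD box_sum_shift //.
elim: M => [|m IH]; first by rewrite big_ord0 addb2.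
by rewrite big_ord_recr /= IH; do 3! case: (box_sum _ _ _).
Qed.

Lemma box_sum_telescope0 r F x i : uniq r -> i \in r ->
  (forall y, y i = 0%N -> F y = 0) -> (forall y, y i = M -> F y = 0) ->
  box_sum r (fun y => F (shift y [set i]) + F y) x = 0.
Proof.
move=> + + F0 FM; elim: r x => [//|k r IH] x /andP[kr ur].
rewrite inE => /orP[/eqP ik|ir]; last first.
  by rewrite /=; apply: big1 => t _; rewrite IH.
rewrite -ik in kr *; rewrite box_sum_telescope // !box_sum_upd //.
rewrite (eq_box_sum _ _ (G := fun=> 0)) ?box_sum0 ?add0r.
  by rewrite (eq_box_sum _ _ (G := fun=> 0)) ?box_sum0 // => y; apply: F0; rewrite ffunE eqxx.
by move=> y; apply: FM; rewrite ffunE eqxx.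
Qed.

Hypothesis s0 : forall i y, y i = 0%N -> s i y = 0.
Hypothesis sM : forall i y, y i = M -> s i y = 1.

(* Stokes: by [cup_cons_coboundary] only the boundary of the box counts, and there only the face
   [y k = M] contributes, namely the same sum in one dimension less. *)
Lemma box_sum_cup r x : uniq r -> box_sum r (fun y => cup r y [set i in r]) x = 1.
Proof.
elim: r x => [//|k r IH] x ukr; have /andP[kr ur] := ukr.
rewrite (eq_box_sum _ _ (fun y => cup_cons_coboundary k r y _)).
pose G i y := cup r y ([set i in k :: r] :\ i) * s k (shift y ([set i in k :: r] :\ i)).
rewrite box_sum_big; set S := box_sum (k :: r).
rewrite (bigD1 k) /=; last by rewrite !inE eqxx.
rewrite big1 => [|i]; last first.
  rewrite !inE => /andP[/orP[->//|ir] ik].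
  apply: (@box_sum_telescope0 _ (G i)) => //; first by rewrite inE ir orbT.
    move=> y y0; rewrite /G (@cup_eq0 _ _ _ i 0) ?mul0r // => B sB; apply: s0.
    by rewrite shift_notin //; apply/negP => /(subsetP sB); rewrite !inE eqxx.
  move=> y y0; rewrite /G (@cup_eq0 _ _ _ i 1) ?mul0r // => B sB; apply: sM.
  by rewrite shift_notin //; apply/negP => /(subsetP sB); rewrite !inE eqxx.
have eA : [set i in k :: r] :\ k = [set i in r].
  by apply/setP => i; rewrite !inE; case: (i =P k) => // ->; rewrite (negbTE kr).
have nkA : k \notin [set i in k :: r] :\ k by rewrite !inE eqxx.
rewrite -[LHS]/(box_sum (k :: r) (fun y => G k (shift y [set k]) + G k y) x + 0).
rewrite addr0 box_sum_telescope //.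
rewrite !box_sum_upd // (@eq_box_sum _ (fun y => G k (upd y k 0)) (fun=> 0)); last first.
  by move=> y; rewrite /G s0 ?mulr0 // shift_notin ?upd_same.
rewrite box_sum0 -(box_sum_upd (G k)) // -(IH (upd x k M) ur) addr0.
rewrite !box_sum_upd //; apply: eq_box_sum => y.
by rewrite /G sM ?mulr1 ?eA // -eA shift_notin ?upd_same.
Qed.

(** By [box_sum_cup] some cell has nonzero cup product, and by [cup_eq0] no [s i] is constant on the
    vertices of that cell. *)
Lemma cubical_sperner : exists x, forall i (v : bool), exists B, s i (shift x B) = v.
Proof.
have /eqP := box_sum_cup [ffun=> 0%N] (enum_uniq 'I_d).
have [[y yn0] _|ny] :=
  excluded_middle_informative (exists y, cup (enum 'I_d) y [set i in enum 'I_d] != 0); last first.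
  rewrite (@eq_box_sum _ _ (fun=> 0)) ?box_sum0 // => y.
  by apply/eqP/negPn/negP => yn0; case: ny; exists y.
exists y => i v.
have [//|nB] := excluded_middle_informative (exists B, s i (shift y B) = v).
case/eqP: yn0; apply: (@cup_eq0 _ _ _ i (~~ v)); first by rewrite mem_enum.
move=> B _; case: (s i (shift y B) =P v) => [sB|]; first by case: nB; exists B.
by case: (s _ _); case: (v).
Qed.

End CubicalCup.

(** * Compactness and sign stability *)

Section Compactness.
Local Open Scope R_scope.

(** Let [m] be the supremum of the [t] with [l, t] small. A small neighbourhood of [m] reaches
    beyond [m], so [u] must already be reached. *)
Lemma interval_ideal (C : (R -> Prop) -> Prop) (l u : R) :
  (forall S T : R -> Prop, (forall t, S t -> T t) -> C T -> C S) ->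
  (forall S T, C S -> C T -> C (fun t => S t \/ T t)) ->
  (forall t, l <= t <= u -> exists e, 0 < e /\ C (fun s => Rabs (s - t) < e)) ->
  l <= u -> C (fun s => l <= s <= u).
Proof.
move=> Cmono CU Cloc lu.
pose E t := l <= t <= u /\ C (fun s => l <= s <= t).
have El : E l.
  split; first lra.
  have [e [e0 Ce]] := Cloc l (conj (Rle_refl l) lu).
  by apply: Cmono Ce => t tl; apply: Rabs_def1; lra.
have [m [mub mlub]] : {m | is_lub E m}.
  by apply: completeness; [exists u => t [tlu _]; lra | exists l].
have lm : l <= m by apply: mub.
have mu : m <= u by apply: mlub => t [tlu _]; lra.
have [e [e0 Ce]] := Cloc m (conj lm mu).
have [t [Et mt]] : exists t, E t /\ m - e < t.
  have [//|nt] := excluded_middle_informative (exists t, E t /\ m - e < t).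
  have : m <= m - e.
    apply: mlub => t Et; apply: Rnot_lt_le => mt; apply: nt; by exists t.
  lra.
have Cm : C (fun s => l <= s <= Rmin u (m + e / 2)).
  apply: Cmono (CU _ _ Et.2 Ce) => s [ls su].
  have [st|ts] := Rle_lt_dec s t; [left; lra|right].
  have := Rmin_r u (m + e / 2).
  by move=> ?; apply: Rabs_def1; lra.
have : Rmin u (m + e / 2) <= m.
  apply: mub; split => //; split; last exact: Rmin_l.
  apply: Rmin_glb; lra.
rewrite /Rmin; case: Rle_dec => um; last lra.
by move=> _; move: Cm; rewrite Rmin_left.
Qed.

Definition near N (x : 'I_N -> R) (e : R) (y : 'I_N -> R) := forall i, Rabs (y i - x i) < e.

Lemma near_le N (x : 'I_N -> R) e e' y : e' <= e -> near x e' y -> near x e y.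
Proof. by move=> ee xy i; have := xy i; lra. Qed.

Lemma near_refl N (x : 'I_N -> R) e : 0 < e -> near x e x.
Proof. by move=> e0 i; rewrite Rminus_diag Rabs_R0. Qed.

Lemma near_trans N (x y z : 'I_N -> R) e e' : near x e y -> near y e' z -> near x (e + e') z.
Proof.
move=> xy yz i; have := xy i; have := yz i.
have -> : z i - x i = (z i - y i) + (y i - x i) by lra.
have := Rabs_triang (z i - y i) (y i - x i); lra.
Qed.

(* Heine-Borel: [C] is an ideal of "small" sets, and a box that is locally small is small. *)
Lemma box_ideal N (C : (('I_N -> R) -> Prop) -> Prop) (l u : 'I_N -> R) :
  (forall S T : ('I_N -> R) -> Prop, (forall t, S t -> T t) -> C T -> C S) ->
  (forall S T, C S -> C T -> C (fun t => S t \/ T t)) ->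
  (forall x, (forall i, l i <= x i <= u i) -> exists e, 0 < e /\ C (near x e)) ->
  (forall i, l i <= u i) -> C (fun x => forall i, l i <= x i <= u i).
Proof.
move=> Cmono CU Cloc lu.
(* Tube lemma: coordinates in [r] fill their intervals while the others stay near [x]. Each new
   coordinate is filled by [interval_ideal], applied to the ideal [C1]. *)
have tube (r : seq 'I_N) x : uniq r -> (forall i, l i <= x i <= u i) -> exists e, 0 < e /\
    C (fun y => forall i, if i \in r then l i <= y i <= u i else Rabs (y i - x i) < e).
  elim: r x => [|k r IH] x; first by move=> _ /Cloc [e [e0 Ce]]; exists e.
  move=> /andP[kr ur] xlu.
  pose C1 T := exists e, 0 < e /\ C (fun y : 'I_N -> R => T (y k) /\
    forall i, i != k -> if i \in r then l i <= y i <= u i else Rabs (y i - x i) < e).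
  have [||t tlu|e [e0 Ce]] := @interval_ideal C1 (l k) (u k) _ _ _ (lu k).
  - move=> S T ST [e [e0 Ce]]; exists e; split=> //.
    by apply: Cmono Ce => y [Sy yr]; split=> //; apply: ST.
  - move=> S T [e [e0 Ce]] [e' [e'0 Ce']]; exists (Rmin e e'); split; first exact: Rmin_pos.
    apply: Cmono (CU _ _ Ce Ce') => y [[Sy|Ty] yr]; [left|right]; split=> // i /yr.
      by case: (i \in r) => //; have := Rmin_l e e'; lra.
    by case: (i \in r) => //; have := Rmin_r e e'; lra.
  - have [i|e [e0 Ce]] := IH (fun i => if i == k then t else x i) ur.
      by case: eqP => [->|].
    exists e; split=> //; exists e; split=> //; apply: Cmono Ce => y [yt yr] i.
    case: (eqVneq i k) => [->|ik]; first by rewrite (negbTE kr).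
    exact: yr.
  - exists e; split=> //; apply: Cmono Ce => y yr; split.
      by have := yr k; rewrite inE eqxx.
    by move=> i ik; have := yr i; rewrite inE (negbTE ik).
have [|e [e0 Ce]] := @tube (enum 'I_N) l (enum_uniq _).
  by move=> i; have := lu i; lra.
by apply: Cmono Ce => y yr i; rewrite mem_enum; apply: yr.
Qed.

Lemma fin_pos (I : finType) (Q : I -> R -> Prop) :
  (forall i e e', e' <= e -> Q i e -> Q i e') ->
  (forall i, exists e, 0 < e /\ Q i e) -> exists e, 0 < e /\ forall i, Q i e.
Proof.
move=> Qle Qex.
have [e [e0 Qe]] : exists e, 0 < e /\ forall i, i \in enum I -> Q i e.
  elim: (enum I) => [|j r [e [e0 Qe]]]; first by exists 1; split => //; lra.
  have [e' [e'0 Qe']] := Qex j.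
  exists (Rmin e e'); split; first exact: Rmin_pos.
  move=> i; rewrite inE => /orP[/eqP->|ir].
    by apply: Qle Qe'; apply: Rmin_r.
  by apply: Qle (Qe i ir); apply: Rmin_l.
by exists e; split=> // i; apply: Qe; rewrite mem_enum.
Qed.

Definition cont_at N (f : ('I_N -> R) -> R) x :=
  forall e, 0 < e -> exists del, 0 < del /\ forall y, near x del y -> Rabs (f y - f x) < e.

Lemma cont_at_const N c x : @cont_at N (fun=> c) x.
Proof. by move=> e e0; exists 1; split=> [|y _]; [lra | rewrite Rminus_diag Rabs_R0]. Qed.

Lemma cont_at_proj N i x : @cont_at N (fun y => y i) x.
Proof. by move=> e e0; exists e; split. Qed.

Lemma cont_at_plus N f g x : @cont_at N f x -> cont_at g x -> cont_at (fun y => f y + g y) x.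
Proof.
move=> fx gx e e0; have e20 : 0 < e / 2 by lra.
have [d1 [d10 fd]] := fx _ e20; have [d2 [d20 gd]] := gx _ e20.
exists (Rmin d1 d2); split=> [|y xy]; first exact: Rmin_pos.
have := fd y (near_le (Rmin_l _ _) xy); have := gd y (near_le (Rmin_r _ _) xy).
have -> : f y + g y - (f x + g x) = (f y - f x) + (g y - g x) by lra.
have := Rabs_triang (f y - f x) (g y - g x); lra.
Qed.

Lemma cont_at_mult N f g x : @cont_at N f x -> cont_at g x -> cont_at (fun y => f y * g y) x.
Proof.
move=> fx gx e e0.
(* If both errors are below [h <= 1], the error of the product is below h + |f x| h + |g x| h = h K,
   hence below [e]. *)
pose K := 1 + Rabs (f x) + Rabs (g x).
have K1 : 1 <= K by rewrite /K; have := Rabs_pos (f x); have := Rabs_pos (g x); lra.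
pose h := Rmin 1 (e / K).
have h0 : 0 < h by apply: Rmin_pos; [lra | apply: Rdiv_lt_0_compat; lra].
have [d1 [d10 fd]] := fx _ h0; have [d2 [d20 gd]] := gx _ h0.
exists (Rmin d1 d2); split=> [|y xy]; first exact: Rmin_pos.
have fh := fd y (near_le (Rmin_l _ _) xy); have gh := gd y (near_le (Rmin_r _ _) xy).
have -> : f y * g y - f x * g x = (f y - f x) * (g y - g x) + f x * (g y - g x) + (f y - f x) * g x.
  by lra.
apply: Rle_lt_trans (Rabs_triang _ _) _; apply: Rle_lt_trans.
  by apply: Rplus_le_compat_r; apply: Rabs_triang.
rewrite !Rabs_mult.
have hK : h * K <= e.
  have := Rmin_r 1 (e / K); rewrite -/h => he.
  have -> : e = e / K * K by field; lra.
  by apply: Rmult_le_compat_r; lra.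
have h1 : h <= 1 := Rmin_l _ _.
move: (Rabs_pos (f x)) (Rabs_pos (g x)) (Rabs_pos (f y - f x)) (Rabs_pos (g y - g x)).
move: fh gh hK h0; rewrite /K.
move: (Rabs (f x)) (Rabs (g x)) (Rabs (f y - f x)) (Rabs (g y - g x)) => F G p q ph qh hK h0 F0 G0 p0 q0.
have : p * q <= h * q by apply: Rmult_le_compat_r; lra.
have : h * q < h * 1 by apply: Rmult_lt_compat_l; lra.
have : F * q <= F * h by apply: Rmult_le_compat_l; lra.
have : p * G <= h * G by apply: Rmult_le_compat_r; lra.
lra.
Qed.

Lemma cont_at_mpoly_eval N (p : mpoly N) x : cont_at (mpoly_eval p) x.
Proof.
have cpow n i : @cont_at N (fun y => pow (y i) n) x.
  elim: n => [|n IH]; first exact: cont_at_const.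
  exact: (cont_at_mult (cont_at_proj i x) IH).
elim: p => [|[c e] p IH]; first exact: cont_at_const.
apply: (@cont_at_plus _ _ _ x _ IH); apply: (@cont_at_mult _ (fun=> c) (monom_eval e)).
  exact: cont_at_const.
rewrite /monom_eval; elim: (enum 'I_N) => [|i r IHr]; first exact: cont_at_const.
exact: (cont_at_mult (cpow _ i) IHr).
Qed.

Lemma sgn_near u v : Rabs (v - u) < Rabs u -> sgn v = sgn u.
Proof.
have := Rle_abs (v - u); have := Rle_abs (- (v - u)); rewrite Rabs_Ropp => vu uv.
rewrite /sgn; have [u0|[u0|u0]] := Rtotal_order u 0.
- rewrite (Rabs_left u) // => h.
  by case: Rcase_abs => ?; case: Rcase_abs => ? //; lra.
- by rewrite u0 Rabs_R0 => ?; have := Rabs_pos (v - 0); lra.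
- rewrite (Rabs_right u) => [h|]; last lra.
  do 2! case: Rcase_abs => ?; try lra.
  by case: Req_dec_T => ? /=; [lra | case: Req_dec_T => ? //=; lra].
Qed.

Lemma sgn0P u : sgn u = None <-> u = 0.
Proof.
rewrite /sgn; case: Rcase_abs => u0; first by split=> // ?; lra.
by case: Req_dec_T.
Qed.

Lemma near_pair d (a b a' b' : point d) e : near a e a' -> near b e b' ->
  near (pair_pt a b) e (pair_pt a' b').
Proof. by move=> aa bb i; rewrite /pair_pt; case: (split i). Qed.

Lemma sgn_eval2_near d (P : mpoly (d + d)) (a b : point d) : eval2 P a b <> 0 ->
  exists e, 0 < e /\ forall a' b', near a e a' -> near b e b' ->
    sgn (eval2 P a' b') = sgn (eval2 P a b).
Proof.
move=> /Rabs_pos_lt Pab; have [e [e0 Pe]] := @cont_at_mpoly_eval _ P (pair_pt a b) _ Pab.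
exists e; split=> // a' b' aa bb.
by apply: sgn_near; apply: Pe; apply: near_pair.
Qed.

Lemma lab_near d k (L : finType) (P : 'I_k -> mpoly (d + d)) (phi : {ffun 'I_k -> sign} -> L)
    (a b : point d) : (forall s, eval2 (P s) a b <> 0) ->
  exists e, 0 < e /\ forall a' b', near a e a' -> near b e b' ->
    lab P phi a' b' = lab P phi a b /\ forall s, eval2 (P s) a' b' <> 0.
Proof.
move=> Pab.
have [//|s|e [e0 He]] := @fin_pos _ (fun s e => forall a' b', near a e a' -> near b e b' ->
    sgn (eval2 (P s) a' b') = sgn (eval2 (P s) a b)).
- by move=> s e e' ee He a' b' aa bb; apply: He; apply: near_le ee _.
- by apply: sgn_eval2_near.
exists e; split=> // a' b' aa bb; split.
  by congr phi; apply/ffunP => s; rewrite !ffunE He.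
by move=> s /sgn0P; rewrite He // => /sgn0P; apply: Pab.
Qed.

End Compactness.

(** * Polynomial curves *)

Section PolynomialCurves.
Local Open Scope ring_scope.

(** The bound [D] is chosen before the curve [z]. This uniformity later bounds the zeros along the
    curve for all points [a] at once. *)
Lemma mpoly_subst N (p : mpoly N) (D0 : nat) : exists D : nat, forall z : 'I_N -> {poly R},
  (forall i, (size (z i) <= D0)%N) ->
  exists q : {poly R}, (size q <= D)%N /\ forall t, q.[t] = mpoly_eval p (fun i => (z i).[t]).
Proof.
elim: p => [|[c e] p [D IH]].
  by exists 0%N => z _; exists 0; rewrite size_poly0; split=> // t; rewrite horner0.
have [D' mono] : exists D' : nat, forall z : 'I_N -> {poly R}, (forall i, (size (z i) <= D0)%N) ->
    exists q : {poly R}, (size q <= D')%N /\ forall t, q.[t] = monom_eval e (fun i => (z i).[t]).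
  rewrite /monom_eval; elim: (enum 'I_N) => [|i r [D' IHr]].
    by exists 1%N => z _; exists 1; rewrite size_poly1; split=> // t; rewrite hornerC.
  (* Sizes are degrees plus one, whence the shifts by one for the power and the product. *)
  exists (((D0.-1 * e i).+1 + D').-1)%N => z zD; have [q [qD qE]] := IHr z zD.
  exists (z i ^+ e i * q); split=> [|t].
    apply: leq_trans (size_polyMleq _ _) _; rewrite -!subn1 leq_sub2r // leq_add //.
    apply: leq_trans (size_poly_exp_leq _ _) _; rewrite ltnS leq_mul2r -!subn1 leq_sub2r ?orbT //.
  by rewrite hornerM horner_exp qE -RpowE.
exists (maxn D' D) => z zD; have [q [qD qE]] := IH z zD; have [q' [qD' qE']] := mono z zD.
exists (c *: q' + q); split=> [|t]; last by rewrite hornerD hornerZ qE qE'.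
apply: leq_trans (size_polyD _ _) _; rewrite geq_max !leq_max qD orbT andbT.
by rewrite (leq_trans (size_scale_leq _ _)).
Qed.

Lemma eval2_curve d (P : mpoly (d + d)) (D0 : nat) :
  exists D : nat, forall (a : point d) (g : 'I_d -> {poly R}), (forall i, (size (g i) <= D0)%N) ->
  exists q : {poly R}, (size q <= D)%N /\ forall t, q.[t] = eval2 P a (fun i => (g i).[t]).
Proof.
(* The coordinates of [a] are substituted as constant polynomials, of size at most 1. *)
have [D PD] := mpoly_subst P (maxn 1 D0); exists D => a g gD.
have [|q [qD qE]] := PD (fun i => match split i with inl j => (a j)%:P | inr j => g j end).
  move=> i; case: (split i) => j; rewrite leq_max; first by rewrite size_polyC_leq1.
  by rewrite gD orbT.
exists q; split=> // t; rewrite qE /eval2; congr mpoly_eval.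
apply: functional_extensionality => i; rewrite /pair_pt; case: (split i) => j //.
by rewrite hornerC.
Qed.

Lemma horner_near (q : {poly R}) x e : Rlt 0 e ->
  exists del, Rlt 0 del /\ forall t, Rlt (Rabs (Rminus t x)) del -> Rlt (Rabs (Rminus q.[t] q.[x])) e.
Proof.
have qx : @cont_at 1 (fun y => q.[y ord0]) (fun=> x).
  elim/poly_ind: q => [|q c IH].
    by move=> e' e0'; exists R1; split=> [|y _]; [lra | rewrite !horner0 Rminus_diag Rabs_R0].
  suff : @cont_at 1 (fun y => Rplus (Rmult q.[y ord0] (y ord0)) c) (fun=> x).
    move=> qc e' /qc [del [del0 qdel]]; exists del; split=> // y /qdel.
    by rewrite !hornerMXaddC.
  apply: cont_at_plus; last exact: cont_at_const.
  by apply: cont_at_mult => //; apply: cont_at_proj.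
move=> /qx [del [del0 qd]]; exists del; split=> // t tx.
exact: (qd (fun=> t)).
Qed.

Lemma curve_near d (g : 'I_d -> {poly R}) x e : Rlt 0 e ->
  exists del, Rlt 0 del /\ forall t, Rlt (Rabs (Rminus t x)) del ->
    near (fun i => (g i).[x]) e (fun i => (g i).[t]).
Proof.
move=> e0; have [||del [del0 gd]] := @fin_pos _ (fun i del => forall t,
  Rlt (Rabs (Rminus t x)) del -> Rlt (Rabs (Rminus (g i).[t] (g i).[x])) e).
- by move=> i d1 d2 d21 gi t tx; apply: gi; lra.
- by move=> i; apply: horner_near.
by exists del; split=> // t tx i; apply: gd.
Qed.

Lemma interpolation (ys : seq R) :
  exists q : {poly R}, forall r, (r < size ys)%N -> q.[INR r] = ys`_r.
Proof.
elim/last_ind: ys => [|ys y [q qE]]; first by exists 0.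
(* Newton interpolation: [w] vanishes at the earlier nodes, so a multiple of it corrects only the
   value at the new node. *)
pose w := \prod_(j < size ys) ('X - (INR j)%:P).
have wn0 : w.[INR (size ys)] != 0.
  rewrite horner_prod; apply/prodf_neq0 => j _; rewrite hornerXsubC subr_eq0.
  by apply/eqP => /INR_eq sj; have := ltn_ord j; rewrite -sj ltnn.
exists (q + ((y - q.[INR (size ys)]) / w.[INR (size ys)]) *: w) => r.
rewrite size_rcons ltnS leq_eqVlt nth_rcons hornerD hornerZ => /orP[/eqP->|rs].
  by rewrite ltnn eqxx divfK // addrC subrK.
have -> : w.[INR r] = 0.
  by rewrite horner_prod (bigD1 (Ordinal rs)) //= hornerXsubC subrr mul0r.
by rewrite rs qE // mulr0 addr0.
Qed.

Lemma curve_through d (l : seq (point d)) (x0 : point d) :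
  exists g : 'I_d -> {poly R}, forall r, (r < size l)%N ->
    (fun i => (g i).[INR r]) = nth x0 l r.
Proof.
have [g gE] := fin_all_exists (fun i => interpolation [seq b i | b <- l]).
exists g => r rl; apply: functional_extensionality => i.
by rewrite gE ?size_map // (nth_map x0).
Qed.

(** On the line from [b] to [v] the values form a polynomial that is nonzero at parameter 1, so only
    finitely many parameters near 0 are bad. *)
Lemma eval2_generic d (P : mpoly (d + d)) (a b v : point d) e :
  eval2 P a v <> 0 -> Rlt 0 e -> exists b', near b e b' /\ eval2 P a b' <> 0.
Proof.
move=> Pv e0; pose g i : {poly R} := (b i)%:P + (v i - b i) *: 'X.
have gE t i : (g i).[t] = b i + (v i - b i) * t by rewrite hornerD hornerC hornerZ hornerX.
have [D PD] := eval2_curve P (\max_i size (g i))%N.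
have [|q [_ qE]] := PD a g; first by move=> i; apply: (leq_bigmax i).
have q0 : q != 0.
  apply/eqP => q0; apply: Pv; rewrite -(horner0 1) -q0 qE; congr eval2.
  by apply: functional_extensionality => i; rewrite gE mulr1 addrC subrK.
have [del [del0 gd]] := curve_near g 0 e0.
(* Infinitely many distinct parameters; starting the denominators at 2 keeps them strictly below
   [del]. *)
pose t (j : nat) := Rdiv del (INR j.+2).
have t0 j : Rlt 0 (t j) by apply: Rdiv_lt_0_compat => //; apply: lt_0_INR; apply/ltP.
have tdel j : Rlt (t j) del.
  have j1 : Rlt 1 (INR j.+2) by apply: (lt_INR 1); apply/ltP.
  apply: (Rmult_lt_reg_r (INR j.+2)); first lra.
  rewrite /t /Rdiv Rmult_assoc Rinv_l; last lra.
  by apply: Rmult_lt_compat_l.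
have tinj : injective t.
  move=> i j /(Rmult_eq_reg_l _ _ _) => ij.
  have /Rinv_eq_reg /INR_eq [//] := ij (Rgt_not_eq _ _ del0).
have [/allP qt|] := boolP (all (root q) (map t (iota 0 (size q)))).
  have := max_poly_roots q0 (introT allP qt).
  by rewrite map_inj_uniq // iota_uniq size_map size_iota ltnn => /(_ isT).
rewrite -has_predC => /hasP[_ /mapP[j _ ->]] /= /eqP qj.
exists (fun i => (g i).[t j]); split; last by rewrite -qE.
have -> : b = (fun i => (g i).[0]).
  by apply: functional_extensionality => i; rewrite gE mulr0 addr0.
apply: gd; have := t0 j; have := tdel j => ? ?; apply: Rabs_def1; rewrite -/(IZR 0); lra.
Qed.

End PolynomialCurves.

(** * Separated points in a cube *)

Lemma bigminn_le (I : finType) (A : pred I) (F : I -> nat) N i :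
  A i -> \big[minn/N]_(j | A j) F j <= F i.
Proof.
move=> Ai; have := mem_index_enum i; elim: (index_enum I) => [//|j r IH].
rewrite inE big_cons => /orP[/eqP<-|/IH ri]; first by rewrite Ai geq_minl.
by case: (A j); rewrite // geq_min ri orbT.
Qed.

Section Cells.
Variables (L : finType) (d k : nat) (P : 'I_k -> mpoly (d + d)).
Variables (phi : {ffun 'I_k -> sign} -> L) (U : point d -> Prop).
Hypothesis openU : is_open U.
Hypothesis sepU : forall a a' : point d, U a -> U a' -> (exists i, a i <> a' i) ->
  exists b : point d, U b /\
    (forall s, eval2 (P s) a b <> R0 /\ eval2 (P s) a' b <> R0) /\
    lab P phi a b <> lab P phi a' b.

(** * Finitely many separators for a cube *)

Section Cube.
Local Open Scope R_scope.
Variables (x0 : point d) (w : R).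
Hypothesis w0 : 0 < w.

Definition cube (a : point d) := forall i, x0 i <= a i <= x0 i + w.

Hypothesis cubeU : forall a, cube a -> U a.

(** With the threshold [w / 2], opposite faces of the cube are far apart and every point of the cube
    has a far partner in it. *)
Definition far (a a' : point d) := exists i, w / 2 <= Rabs (a i - a' i).

(** Heine-Borel on pairs (a, a') in the product cube. The nonvanishing at the separator itself later
    shows that the polynomials do not vanish identically along the curve. *)
Lemma cube_separators : exists (l : seq (point d)) (eta : R), 0 < eta /\
  (forall r b, (r < size l)%N -> near (nth x0 l r) eta b -> U b) /\
  forall a a', cube a -> cube a' -> far a a' -> exists2 r, (r < size l)%N &
    (forall s, eval2 (P s) a (nth x0 l r) <> 0) /\
    forall b, near (nth x0 l r) eta b -> lab P phi a b <> lab P phi a' b.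
Proof.
pose C (S : ('I_(d + d) -> R) -> Prop) := exists (l : seq (point d)) (eta : R), 0 < eta /\
  (forall r b, (r < size l)%N -> near (nth x0 l r) eta b -> U b) /\
  forall a a', S (pair_pt a a') -> far a a' -> exists2 r, (r < size l)%N &
    (forall s, eval2 (P s) a (nth x0 l r) <> 0) /\
    forall b, near (nth x0 l r) eta b -> lab P phi a b <> lab P phi a' b.
pose hi : point d := fun i => x0 i + w.
have [||x xbox||l [eta [eta0 [lU lP]]]] := @box_ideal _ C (pair_pt x0 x0) (pair_pt hi hi).
- move=> S T ST [l [eta [eta0 [lU lP]]]]; exists l, eta; split=> //; split=> // a a' /ST; exact: lP.
- move=> S T [l [e [e0 [lU lP]]]] [l' [e' [e'0 [lU' lP']]]]; exists (l ++ l'), (Rmin e e').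
  split; first exact: Rmin_pos.
  split=> [r b|a a' [Sa|Ta] aa'].
  + rewrite size_cat nth_cat; have [rl _|rl rl'] := ltnP r (size l) => rb.
      by apply: (lU r) => //; apply: near_le rb; apply: Rmin_l.
    by apply: (lU' (r - size l)%N); [rewrite ltn_subLR | apply: near_le rb; apply: Rmin_r].
  + have [r rl [Pr lr]] := lP a a' Sa aa'.
    exists r; first by rewrite size_cat ltn_addr.
    rewrite nth_cat rl; split=> // b bb; apply: lr; apply: near_le bb; exact: Rmin_l.
  + have [r rl [Pr lr]] := lP' a a' Ta aa'.
    exists (size l + r)%N; first by rewrite size_cat ltn_add2l.
    rewrite nth_cat ltnNge leq_addr addKn /=; split=> // b bb; apply: lr.
    by apply: near_le bb; exact: Rmin_r.
- pose a0 : point d := fun i => x (lshift d i); pose a1 : point d := fun i => x (rshift d i).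
  have xE e a a' : near x e (pair_pt a a') -> near a0 e a /\ near a1 e a'.
    move=> xa; split=> i.
      by have := xa (lshift d i); rewrite /pair_pt (unsplitK (inl i)).
    by have := xa (rshift d i); rewrite /pair_pt (unsplitK (inr i)).
  have a0U : U a0.
    by apply: cubeU => i; have := xbox (lshift d i); rewrite /pair_pt (unsplitK (inl i)).
  have a1U : U a1.
    by apply: cubeU => i; have := xbox (rshift d i); rewrite /pair_pt (unsplitK (inr i)).
  have [ne|eq] := excluded_middle_informative (exists i, a0 i <> a1 i); last first.
    (* Around a diagonal pair both points stay within [w / 4] of one point, so they are never far
       and need no separator. *)
    exists (w / 4); split; first lra.
    exists [::], 1; split; first lra.
    split=> // a a' /xE[na na'] [i wi].
    have ei : a0 i = a1 i by apply: NNPP => ?; apply: eq; exists i.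
    have := na i; have := na' i; rewrite -ei.
    have := Rabs_triang (a i - a0 i) (- (a' i - a0 i)); rewrite Rabs_Ropp; move: wi.
    have -> : a i - a' i = (a i - a0 i) + - (a' i - a0 i) by lra.
    lra.
  have [b [Ub [Pb lb]]] := sepU a0U a1U ne.
  have [e1 [e10 H1]] := lab_near phi (fun s => (Pb s).1).
  have [e2 [e20 H2]] := lab_near phi (fun s => (Pb s).2).
  have [e3 [e30 H3]] := openU Ub.
  pose e := Rmin e1 (Rmin e2 e3).
  have e0 : 0 < e by do 2! (apply: Rmin_pos => //).
  have ee1 : e <= e1 by apply: Rmin_l.
  have ee2 : e <= e2 by apply: Rle_trans (Rmin_r _ _) (Rmin_l _ _).
  have ee3 : e <= e3 by apply: Rle_trans (Rmin_r _ _) (Rmin_r _ _).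
  exists e; split=> //; exists [:: b], e; split=> //; split=> [[|//] b' _ bb'|].
    by apply: H3; apply: near_le ee3 bb'.
  move=> a a' /xE[na na'] _; exists 0%N => //=; split=> [s|b' bb'].
    exact: (H1 a b (near_le ee1 na) (near_refl _ e10)).2.
  rewrite (H1 a b' (near_le ee1 na) (near_le ee1 bb')).1.
  by rewrite (H2 a' b' (near_le ee2 na') (near_le ee2 bb')).1.
- by move=> i; rewrite /pair_pt /hi; case: (split i) => j; lra.
exists l, eta; split=> //; split=> // a a' ca ca'; apply: lP => i; rewrite /pair_pt /hi.
by case: (split i).
Qed.

(** Guarantees that each point of the cube occurs in a separated pair, hence has a separator at
    which no polynomial vanishes. *)
Lemma far_cube a : (0 < d)%N -> cube a -> exists2 a', cube a' & far a a'.
Proof.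
move=> d0 ca; pose i0 := Ordinal d0; have [h|h] := Rle_lt_dec (x0 i0 + w / 2) (a i0).
  exists x0; first by move=> i; lra.
  by exists i0; rewrite Rabs_right; lra.
exists (fun i => x0 i + w); first by move=> i; lra.
by exists i0; rewrite Rabs_left; lra.
Qed.

End Cube.

(** * The discrepancy pseudometric *)

Section TestPoints.
Variables (T : finType) (B : T -> point d).

Definition discrepancy (a a' : point d) : nat := #|[set j | lab P phi a (B j) != lab P phi a' (B j)]|.

Definition singular (a : point d) : {set T} := [set j | [exists s, eval2 (P s) a (B j) == R0]].

Lemma discrepancyC a a' : discrepancy a a' = discrepancy a' a.
Proof. by apply: eq_card => j; rewrite !inE eq_sym. Qed.

Lemma discrepancy_refl a : discrepancy a a = 0.
Proof. by apply: eq_card0 => j; rewrite !inE eqxx. Qed.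

Lemma discrepancy_triangle a a' a'' : discrepancy a a'' <= discrepancy a a' + discrepancy a' a''.
Proof.
apply: leq_trans (leq_card_setU _ _); apply: subset_leq_card; apply/subsetP => j.
by rewrite !inE -negb_and; apply: contra => /andP[/eqP-> /eqP->].
Qed.

Lemma singularP a j s : j \notin singular a -> eval2 (P s) a (B j) <> R0.
Proof. by rewrite inE negb_exists => /forallP/(_ s)/eqP. Qed.

(** At most [2 * J] test points are singular for one of the two points, so one of the disagreements
    is at a nonsingular test point. *)
Lemma discrepancy_separates J a a' : #|singular a| <= J -> #|singular a'| <= J ->
  2 * J < discrepancy a a' -> exists2 j, j \notin singular a /\ j \notin singular a' &
    lab P phi a (B j) <> lab P phi a' (B j).
Proof.
move=> aJ a'J; rewrite ltnNge => /negP Jd.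
have [//|nj] := excluded_middle_informative (exists2 j, j \notin singular a /\ j \notin singular a' &
    lab P phi a (B j) <> lab P phi a' (B j)).
case: Jd; rewrite mul2n -addnn; apply: leq_trans (leq_add aJ a'J).
apply: leq_trans (leq_card_setU _ _); apply: subset_leq_card; apply/subsetP => j.
rewrite in_set in_setU => /eqP lj; apply/negPn/negP; rewrite negb_or => /andP[ja ja'].
by apply: nj; exists j.
Qed.

(** Near [x] only labels towards the singular test points of [x] can change; compactness makes the
    radius uniform. *)
Lemma discrepancy_uniform x0 w J : Rlt R0 w -> (forall a, cube x0 w a -> #|singular a| <= J) ->
  exists del, Rlt R0 del /\ forall a a', cube x0 w a -> near a del a' -> discrepancy a a' <= J.
Proof.
move=> w0 singJ.
pose C (S : point d -> Prop) := exists del, Rlt R0 del /\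
  forall a a', S a -> near a del a' -> discrepancy a a' <= J.
have [||x cx||del [del0 delP]] := @box_ideal _ C x0 (fun i => Rplus (x0 i) w).
- by move=> S S' SS' [del [del0 delP]]; exists del; split=> // a a' /SS'; apply: delP.
- move=> S S' [e [e0 eP]] [e' [e'0 eP']]; exists (Rmin e e'); split; first exact: Rmin_pos.
  move=> a a' [Sa|Sa] aa'.
    exact: eP Sa (near_le (Rmin_l _ _) aa').
  exact: eP' Sa (near_le (Rmin_r _ _) aa').
- have [||e [e0 eP]] := @fin_pos _ (fun j e => j \in singular x \/
     forall a', near x e a' -> lab P phi a' (B j) = lab P phi x (B j)).
  + move=> j e e' ee [|Hj]; [by left|right=> a' xa'].
    by apply: Hj; apply: near_le ee xa'.
  + move=> j; have [jx|jx] := boolP (j \in singular x).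
      by exists R1; split; [lra | left].
    have [e [e0 eP]] := lab_near phi (fun s => singularP (s := s) jx).
    exists e; split=> //; right=> a' xa'.
    by rewrite (eP a' (B j) xa' (near_refl _ e0)).1.
  (* One half for [a] near [x], the other for [a'] near [a], so that both lie within [e] of [x]. *)
  exists (Rdiv e 2); split; first lra.
  exists (Rdiv e 2); split; first lra.
  move=> a a' xa aa'; apply: leq_trans (singJ x cx); apply: subset_leq_card.
  apply/subsetP => j; rewrite in_set; apply: contraR => jx; apply/eqP.
  have [|ej] := eP j; first by rewrite (negbTE jx).
  rewrite !ej //; last by apply: near_le xa; lra.
  by have := near_trans xa aa'; apply: near_le; lra.
- by move=> i; lra.
by exists del; split.
Qed.

Section Grid.
Variables (x0 : point d) (w : R) (J p Q : nat).
Hypothesis w0 : Rlt R0 w.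
Hypothesis singJ : forall a, cube x0 w a -> #|singular a| <= J.
Hypothesis farp : forall a a', cube x0 w a -> cube x0 w a' -> far w a a' -> p <= discrepancy a a'.
Hypothesis Qp : (4 * J + 1) * Q <= p.

(* Apply the Sperner lemma to the conditions "distance to the lower [i]-face exceeds
   [(4 * J + 1) * q i]" on a grid so fine that neighbours have discrepancy at most [J]. *)
Lemma discrepancy_cells : exists x : {ffun 'I_d -> 'I_Q} -> point d, (forall q, cube x0 w (x q)) /\
  forall q q', q != q' -> 2 * J < discrepancy (x q) (x q').
Proof.
have [del [del0 delP]] := discrepancy_uniform w0 singJ.
have [M M0 wM] : exists2 M, 0 < M & Rlt (Rdiv w (INR M)) del.
  have [M [Mw]] := archimed_cor1 (Rdiv del w) (Rdiv_lt_0_compat _ _ del0 w0).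
  move=> /ltP M0; exists M => //.
  have := Rmult_lt_compat_r w _ _ w0 Mw; rewrite /Rdiv Rmult_assoc Rinv_l; lra.
have IM0 : Rlt R0 (INR M) by apply: lt_0_INR; apply/ltP.
pose pt (g : {ffun 'I_d -> 'I_M.+1}) : point d := fun i => Rplus (x0 i) (Rmult (Rdiv w (INR M)) (INR (g i))).
have wM0 : Rlt R0 (Rdiv w (INR M)) by apply: Rdiv_lt_0_compat.
have wMM : Rmult (Rdiv w (INR M)) (INR M) = w by field; lra.
have ptcube g : cube x0 w (pt g).
  move=> i; have gM : Rle (INR (g i)) (INR M) by apply: le_INR; apply/leP; rewrite -ltnS.
  have g0 := pos_INR (g i); rewrite /pt.
  have := Rmult_le_compat_l _ _ _ (Rlt_le _ _ wM0) gM.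
  have := Rmult_le_pos _ _ (Rlt_le _ _ wM0) g0; lra.
(* The cell found by [cubical_sperner] may stick out of the grid; clipping brings its vertices
   back. *)
pose clip (y : {ffun 'I_d -> nat}) : {ffun 'I_d -> 'I_M.+1} := [ffun i => inord (minn (y i) M)].
have clipE y i : clip y i = minn (y i) M :> nat.
  by rewrite ffunE inordK // ltnS geq_minr.
have clip_shift y A : discrepancy (pt (clip y)) (pt (clip (shift y A))) <= J.
  apply: delP => // i; rewrite /pt !clipE.
  have : INR (minn (shift y A i) M) = INR (minn (y i) M) \/
      INR (minn (shift y A i) M) = Rplus (INR (minn (y i) M)) 1.
    rewrite -S_INR ffunE; case: (i \in A) => /=; last by left; rewrite addn0.
    have : minn (y i + 1) M = minn (y i) M \/ minn (y i + 1) M = (minn (y i) M).+1 by lia.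
    by case=> ->; [left|right].
  by case=> ->; apply: Rabs_def1; lra.
(* Distance to the lower [i]-face. The default [#|T|] is harmless, since no discrepancy exceeds
   it. *)
pose f i g := \big[minn/#|T|]_(z : {ffun 'I_d -> 'I_M.+1} | z i == ord0) discrepancy (pt g) (pt z).
have f_le i g (z : {ffun 'I_d -> 'I_M.+1}) : z i = ord0 -> f i g <= discrepancy (pt g) (pt z).
  by move=> /eqP z0; apply: bigminn_le.
have le_f i g D : D <= #|T| ->
    (forall z : {ffun 'I_d -> 'I_M.+1}, z i = ord0 -> D <= discrepancy (pt g) (pt z)) -> D <= f i g.
  move=> DT DP; rewrite /f; elim/big_ind: _ => [//|u v Du Dv|z /eqP/DP //].
  by rewrite leq_min Du.
have f_lip i g g' : f i g <= f i g' + discrepancy (pt g) (pt g').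
  rewrite addnC -leq_subLR; apply: le_f.
    rewrite leq_subLR; apply: leq_trans (leq_addl _ _).
    by rewrite /f; elim/big_rec: _ => // z u _ uT; rewrite geq_min uT orbT.
  move=> z z0; rewrite leq_subLR; apply: leq_trans (f_le _ _ _ z0) _.
  exact: discrepancy_triangle.
have f_low i (g : {ffun 'I_d -> 'I_M.+1}) : g i = ord0 -> f i g = 0.
  by move=> g0; apply/eqP; rewrite -leqn0 -(discrepancy_refl (pt g)) f_le.
have f_high i (g : {ffun 'I_d -> 'I_M.+1}) : g i = M :> nat -> p <= f i g.
  move=> gM; have pd (z : {ffun 'I_d -> 'I_M.+1}) : z i = ord0 -> p <= discrepancy (pt g) (pt z).
    move=> z0; apply: farp => //; exists i; rewrite /pt gM z0 wMM /= Rabs_right; lra.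
  apply: (le_f _ _ _ _ pd); apply: leq_trans (pd [ffun=> ord0] _) _; first by rewrite ffunE.
  exact: max_card.
(* The cell has vertices on both sides of the level [(4 * J + 1) * q i]; moving to its corner costs
   at most [J] each way. *)
have cell (q : {ffun 'I_d -> 'I_Q}) : exists g, forall i,
    f i g <= (4 * J + 1) * q i + J /\ (4 * J + 1) * q i < f i g + J.
  have [||y yP] := @cubical_sperner d (fun i y => (4 * J + 1) * q i < f i (clip y)) M.
  - move=> i y y0; rewrite f_low //; apply/val_inj; rewrite [LHS]clipE y0 min0n //.
  - move=> i y yM; apply: leq_trans (f_high _ _ _); last by rewrite clipE yM minnn.
    by apply: leq_trans Qp; rewrite ltn_mul2l ltn_ord addn1.
  exists (clip y) => i; split.
    have [A] := yP i false => /negbT; rewrite -leqNgt => fA.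
    by apply: leq_trans (f_lip i _ (clip (shift y A))) _; apply: leq_add.
  have [A] := yP i true => fA; apply: leq_trans fA _.
  apply: leq_trans (f_lip i _ (clip y)) _; rewrite leq_add2l discrepancyC; exact: clip_shift.
have [g gP] := fin_all_exists cell.
exists (fun q => pt (g q)); split=> [q|q q' qq' /=]; first exact: ptcube.
have [i qi] : exists i, q i != q' i.
  apply/existsP; rewrite -negb_forall; apply: contra qq' => /forallP qq'.
  by apply/eqP/ffunP => i; apply/eqP.
have [qu ql] := gP q i; have [qu' ql'] := gP q' i.
(* Levels are at least [4 * J + 1] apart; an error of [J] at each end leaves more than [2 * J]. *)
have gap u v a b e : u < v -> a <= (4 * J + 1) * u + J -> (4 * J + 1) * v < b + J ->
    b <= a + e -> 2 * J < e.
  move=> uv au bv ba; have : (4 * J + 1) * u.+1 <= (4 * J + 1) * v by rewrite leq_mul2l uv orbT.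
  by rewrite mulnS; move: (_ * u) (_ * v) au bv => U1 V1; lia.
have [h|h] : q i < q' i \/ q' i < q i by move: qi; rewrite -val_eqE /=; lia.
  by apply: gap h qu ql' _; rewrite discrepancyC; apply: f_lip.
by apply: gap h qu' ql _; apply: f_lip.
Qed.

End Grid.
End TestPoints.
End Cells.

(** * Configurations and counting *)

Section Configurations.
Variables (L : finType) (d k : nat) (P : 'I_k -> mpoly (d + d)).
Variables (phi : {ffun 'I_k -> sign} -> L) (U : point d -> Prop).
Hypothesis d0 : 0 < d.
Hypothesis openU : is_open U.
Hypothesis sepU : forall a a' : point d, U a -> U a' -> (exists i, a i <> a' i) ->
  exists b : point d, U b /\
    (forall s, eval2 (P s) a b <> R0 /\ eval2 (P s) a' b <> R0) /\
    lab P phi a b <> lab P phi a' b.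

(** Openness provides a second point of [U] next to [a], to which the separation hypothesis
    applies. *)
Lemma nonvanishing_point a : U a -> exists b, forall s, eval2 (P s) a b <> R0.
Proof.
move=> Ua; have [e [e0 eU]] := openU Ua.
have [||b [_ [Pb _]]] := @sepU a (fun i => Rplus (a i) (Rdiv e 2)) Ua.
- by apply: eU => i; rewrite Rabs_right; lra.
- by exists (Ordinal d0); lra.
by exists b => s; have [] := Pb s.
Qed.

(** Triples (i, j, s) are repaired one at a time. Each repair moves only point [j], so little that
    all nonzero values keep their signs; earlier repairs thus survive. *)
Lemma generic_perturbation n (X : 'I_n -> point d) : (forall i, U (X i)) ->
  exists X' : 'I_n -> point d, (forall i, U (X' i)) /\
    forall (i j : 'I_n) s, i < j -> eval2 (P s) (X' i) (X' j) <> R0 /\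
      (eval2 (P s) (X i) (X j) <> R0 -> sgn (eval2 (P s) (X' i) (X' j)) = sgn (eval2 (P s) (X i) (X j))).
Proof.
move=> UX.
pose ev (Y : 'I_n -> point d) (t : 'I_n * 'I_n * 'I_k) := eval2 (P t.2) (Y t.1.1) (Y t.1.2).
have step Y (t : 'I_n * 'I_n * 'I_k) : (forall i, U (Y i)) -> t.1.1 < t.1.2 ->
    exists Y', (forall i, U (Y' i)) /\ ev Y' t <> R0 /\
      forall t', ev Y t' <> R0 -> sgn (ev Y' t') = sgn (ev Y t').
  move=> UY; case: t => [[i j] s] /= ij.
  have [||e1 [e10 H1]] := @fin_pos _ (fun t e => ev Y t <> R0 -> forall a b,
      near (Y t.1.1) e a -> near (Y t.1.2) e b -> sgn (eval2 (P t.2) a b) = sgn (ev Y t)).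
  - by move=> t e e' ee H Yt a b na nb; apply: H => //; apply: near_le ee _.
  - move=> t; have [Yt|Yt] := excluded_middle_informative (ev Y t = R0).
      by exists R1; split; [lra|].
    by have [e [e0 eP]] := sgn_eval2_near Yt; exists e; split.
  have [e2 [e20 H2]] := openU (UY j).
  have [v Pv] := nonvanishing_point (UY i).
  have [y [yn Py]] := eval2_generic (Y j) (Pv s) (Rmin_pos _ _ e10 e20).
  pose Y' l := if l == j then y else Y l.
  have Y'n l : near (Y l) e1 (Y' l).
    rewrite /Y'; case: eqP => [->|_]; last exact: near_refl.
    by apply: near_le yn; apply: Rmin_l.
  exists Y'; split=> [l|].
    rewrite /Y'; case: eqP => // _; apply: H2; apply: near_le yn; exact: Rmin_r.
  split=> [|t' Yt']; last by apply: H1.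
  by rewrite /ev /Y' /= eqxx (_ : i == j = false) //; apply/eqP => ij'; move: ij; rewrite ij' ltnn.
have [X' [UX' [X'n X's]]] : exists X', (forall i, U (X' i)) /\
    (forall t : 'I_n * 'I_n * 'I_k, t \in enum {: 'I_n * 'I_n * 'I_k} -> t.1.1 < t.1.2 -> ev X' t <> R0) /\
    forall t, ev X t <> R0 -> sgn (ev X' t) = sgn (ev X t).
  elim: (enum _) => [|t r [Y [UY [Yn Ys]]]]; first by exists X.
  have [tlt|tge] := boolP (t.1.1 < t.1.2); last first.
    exists Y; split=> //; split=> // t'; rewrite inE => /orP[/eqP->|/Yn //].
    by rewrite (negbTE tge).
  have [Y' [UY' [Y't Y's]]] := step Y t UY tlt.
  exists Y'; split=> //; split=> [t'|t' Xt'].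
    rewrite inE => /orP[/eqP-> //|/Yn Yt'] /Yt' Yn'.
    by move=> /sgn0P; rewrite Y's // => /sgn0P.
  rewrite Y's ?Ys // => /sgn0P; rewrite Ys // => /sgn0P; exact: Xt'.
exists X'; split=> // i j s ij; split; first by apply: (X'n (i, j, s)); rewrite ?mem_enum.
exact: (X's (i, j, s)).
Qed.

Lemma separating_configuration : (exists x, U x) -> exists C, forall Q,
  exists (B : 'I_(C * Q) -> point d) (x : {ffun 'I_d -> 'I_Q} -> point d),
    (forall j, U (B j)) /\ (forall q, U (x q)) /\
    forall q q', q != q' -> exists j, (forall s, eval2 (P s) (x q) (B j) <> R0) /\
      (forall s, eval2 (P s) (x q') (B j) <> R0) /\ lab P phi (x q) (B j) <> lab P phi (x q') (B j).
Proof.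
case=> x0 Ux0; have [e [e0 eU]] := openU Ux0.
pose w := Rdiv e 2; have w0 : Rlt R0 w by rewrite /w; lra.
have cubeU a : cube x0 w a -> U a.
  by move=> ca; apply: eU => i; have := ca i; rewrite /w => ?; apply: Rabs_def1; lra.
have [l [eta [eta0 [lU lP]]]] := cube_separators openU sepU w0 cubeU.
have [g gE] := curve_through l x0.
have [||del [del0 delP]] := @fin_pos 'I_(size l) (fun r del => forall t : R,
   Rlt (Rabs (Rminus t (INR r))) del -> near (nth x0 l r) eta (fun i => (g i).[t])%R).
- by move=> r e1 e2 e21 H t tr; apply: H; lra.
- by move=> r; rewrite -gE //; apply: curve_near.
have [D DP] := fin_all_exists (fun s => eval2_curve (P s) (\max_i size (g i))).
(* Bounds the zeros of all polynomials together along the curve. It is fixed before [Q], so that the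
   constant [C] is too. *)
pose J := \sum_s D s.
exists (size l * (4 * J + 1)) => Q; pose p := (4 * J + 1) * Q.
have separated a a' : cube x0 w a -> cube x0 w a' -> far w a a' -> exists r : 'I_(size l),
    (forall s, eval2 (P s) a (nth x0 l r) <> R0) /\
    forall b, near (nth x0 l r) eta b -> lab P phi a b <> lab P phi a' b.
  by move=> ca ca' aa'; have [r rl rP] := lP a a' ca ca' aa'; exists (Ordinal rl).
pose tau : R := Rmin del 1.
have tau0 : Rlt R0 tau by apply: Rmin_pos => //; lra.
(* Near each node [INR r] lie [p] parameters. Distinctness uses [tau <= 1], and [tau <= del] keeps
   the test points within [eta] of the separator. *)
pose t (j : 'I_(size l) * 'I_p) : R := Rplus (INR j.1) (Rdiv tau (INR j.2.+2)).
pose B j : point d := fun i => (g i).[t j]%R.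
have offset m : Rlt R0 (Rdiv tau (INR m.+2)) /\ Rlt (Rdiv tau (INR m.+2)) tau.
  have j1 : Rlt 1 (INR m.+2) by apply: (lt_INR 1); apply/ltP.
  split; first by apply: Rdiv_lt_0_compat => //; lra.
  apply: (Rmult_lt_reg_r (INR m.+2)); first lra.
  rewrite /Rdiv Rmult_assoc Rinv_l; last lra.
  by apply: Rmult_lt_compat_l.
have tinj : injective t.
  have tau1 : Rle tau 1 := Rmin_r _ _.
  have lt1 i j : t i = t j -> ~ (i.1 < j.1)%N.
    move=> tij /ltP/(le_INR i.1.+1); rewrite S_INR => ij; move: tij; rewrite /t.
    by have [] := offset i.2; have [] := offset j.2; lra.
  move=> i j tij; have e1 : i.1 = j.1.
    apply/val_inj => /=; have := lt1 i j tij; have := lt1 j i (esym tij); lia.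
  move: tij; rewrite /t e1 => /Rplus_eq_reg_l /(Rmult_eq_reg_l _ _ _) => ij.
  have /Rinv_eq_reg /INR_eq [e2] := ij (Rgt_not_eq _ _ tau0).
  by apply/eqP; rewrite -pair_eqE /pair_eq e1 eqxx -val_eqE /= e2 /=.
have Bnear (j : 'I_(size l) * 'I_p) : near (nth x0 l j.1) eta (B j).
  apply: delP; have [h0 h1] := offset j.2; have h2 : Rle tau del := Rmin_l _ _.
  rewrite /t; apply: Rabs_def1; lra.
have singJ a : cube x0 w a -> #|singular P B a| <= J.
  move=> ca; have [a' ca' aa'] := far_cube w0 d0 ca.
  have [r [Pr _]] := separated a a' ca ca' aa'.
  pose Z s := [set j | eval2 (P s) a (B j) == R0].
  have cardZ s : #|Z s| <= D s.
    have [|q [qD qE]] := DP s a g; first by move=> i; apply: (leq_bigmax i).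
    (* The curve passes through separator [r] at parameter [INR r], where [P s] does not vanish. *)
    have q0 : q != 0%R.
      apply/eqP => q0; apply: (Pr s); rewrite -gE // -qE q0 horner0 //.
    apply: leq_trans qD; apply: ltnW.
    have := max_poly_roots q0 (rs := map t (enum (Z s))).
    rewrite size_map -cardE map_inj_uniq // enum_uniq; apply => //.
    by apply/allP => _ /mapP[j jZ ->]; move: jZ; rewrite mem_enum inE /root qE.
  have -> : singular P B a = \bigcup_s Z s.
    apply/setP => j; rewrite in_set; apply/existsP/bigcupP => [[s h]|[s _ h]]; exists s => //.
      by rewrite inE.
    by rewrite inE in h.
  rewrite /J; elim/big_ind2: _ => [|n1 A1 n2 A2 h1 h2|//]; first by rewrite cards0.
  exact: leq_trans (leq_card_setU _ _) (leq_add h1 h2).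
(* All [p] test points near the separator of a far pair see different labels. *)
have farp a a' : cube x0 w a -> cube x0 w a' -> far w a a' -> p <= discrepancy P phi B a a'.
  move=> ca ca' aa'; have [r [_ rP]] := separated a a' ca ca' aa'.
  have cardr : #|[set (r, j) | j in 'I_p]| = p by rewrite card_imset ?card_ord // => i j [].
  apply: leq_trans (_ : #|[set (r, j) | j in 'I_p]| <= _); first by rewrite cardr.
  apply: subset_leq_card; apply/subsetP => _ /imsetP[j _ ->]; rewrite inE; apply/eqP.
  exact: (rP _ (Bnear (r, j))).
have [x [cx xP]] := discrepancy_cells w0 singJ farp (leqnn _).
have cardT : size l * (4 * J + 1) * Q = #|{: 'I_(size l) * 'I_p}|.
  by rewrite card_prod !card_ord mulnA.
exists (fun j => B (enum_val (cast_ord cardT j))), x; split; first by move=> j; apply: lU (Bnear _).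
split=> [q|q q' /xP /discrepancy_separates[||j [jq jq'] lj]]; first exact: cubeU.
- exact: singJ.
- exact: singJ.
exists (cast_ord (esym cardT) (enum_rank j)); rewrite cast_ordKV enum_rankK.
by split=> [s|]; [apply: singularP jq | split=> // s; apply: singularP jq'].
Qed.

(** If two choices differ at the free vertex [i], some test vertex [j] separates the chosen points.
    Test vertices come last, so (i, j) is an edge in this order, and its label survives the
    perturbation. *)
Lemma many_labelings C Q n (B : 'I_(C * Q) -> point d) (x : {ffun 'I_d -> 'I_Q} -> point d) :
  (forall j, U (B j)) -> (forall q, U (x q)) ->
  (forall q q', q != q' -> exists j, (forall s, eval2 (P s) (x q) (B j) <> R0) /\
      (forall s, eval2 (P s) (x q') (B j) <> R0) /\
      lab P phi (x q) (B j) <> lab P phi (x q') (B j)) ->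
  exists cs : seq (labeling (n + C * Q) L), uniq cs /\
    (forall c, c \in cs -> strongly_representable P phi U c) /\ size cs = (Q ^ d) ^ n.
Proof.
move=> UB Ux xB.
pose X (c : {ffun 'I_n -> {ffun 'I_d -> 'I_Q}}) (i : 'I_(n + C * Q)) : point d :=
  match split i with inl i' => x (c i') | inr j => B j end.
have Xl c i : X c (lshift _ i) = x (c i) by rewrite /X (unsplitK (inl i)).
have Xr c j : X c (rshift _ j) = B j by rewrite /X (unsplitK (inr j)).
have UX c i : U (X c i) by rewrite /X; case: (split i).
have [Y YP] := fin_all_exists (fun c => generic_perturbation (UX c)).
pose F c := F_lab P phi (Y c).
have lr (i : 'I_n) (j : 'I_(C * Q)) : (lshift (C * Q) i, rshift n j).1 < (lshift (C * Q) i, rshift n j).2.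
  exact: (ltn_addr j (ltn_ord i)).
have Flab (c : {ffun 'I_n -> {ffun 'I_d -> 'I_Q}}) i j : (forall s, eval2 (P s) (x (c i)) (B j) <> R0) ->
    F c (exist _ (lshift (C * Q) i, rshift n j) (lr i j)) = lab P phi (x (c i)) (B j).
  move=> Pc; rewrite ffunE /=; congr phi; apply/ffunP => s; rewrite !ffunE.
  by have [_] := (YP c).2 _ _ s (lr i j); rewrite Xl Xr; apply.
have Finj : injective F.
  move=> c c' cc'; apply/ffunP => i; apply/eqP/negPn/negP => /xB[j [jc [jc' []]]].
  by rewrite -!Flab // cc'.
exists [seq F c | c <- enum {: {ffun 'I_n -> {ffun 'I_d -> 'I_Q}}}]; split.
  by rewrite map_inj_uniq // enum_uniq.
split; last by rewrite size_map -cardE !card_ffun !card_ord.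
move=> _ /mapP[c _ ->]; exists (Y c); split; first exact: (YP c).1.
by split=> // i j s ij; have [] := (YP c).2 i j s ij.
Qed.

End Configurations.

(** * The asymptotic estimate *)

Lemma INR_expn q m : INR (q ^ m) = pow (INR q) m.
Proof. by elim: m => [|m IH]; rewrite ?expn0 // expnS mult_INR IH. Qed.

Lemma ln_le x y : Rlt 0 x -> Rle x y -> Rle (ln x) (ln y).
Proof. by move=> x0 [xy|->]; [left; apply: ln_increasing | right]. Qed.

(** Take Q = n / E for a large constant E. Then C Q <= (e/2) n and ln Q >= (1 - e/2) ln n, and (1 -
    e/2)^2 >= 1 - e >= 1 - eps. *)
Lemma counting_bound (C d : nat) (eps : R) : Rlt 0 eps ->
  exists N, forall n, N <= n -> exists Q, C * Q <= n /\
    Rle (Rpower (INR n) (Rmult (Rmult (Rminus R1 eps) (INR d)) (INR n)))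
      (INR ((Q ^ d) ^ (n - C * Q))).
Proof.
(* The cap at 1 keeps the factor 1 - e/2 positive. *)
move=> eps0; pose e := Rmin eps 1.
have e0 : Rlt 0 e by apply: Rmin_pos => //; lra.
have e1 : Rle e 1 := Rmin_r _ _.
have eeps : Rle e eps := Rmin_l _ _.
have [E EC] := INR_unbounded (Rdiv (Rmult 2 (INR C.+1)) e).
have EC' : Rlt (Rmult 2 (INR C.+1)) (Rmult e (INR E)).
  have := Rmult_lt_compat_l _ _ _ e0 EC.
  have -> : Rmult e (Rdiv (Rmult 2 (INR C.+1)) e) = Rmult 2 (INR C.+1) by field; lra.
  by [].
have C1 : Rle 1 (INR C.+1) by apply: (le_INR 1); apply/leP.
have E2 : Rlt 0 (INR E) by apply: (Rmult_lt_reg_l e) => //; lra.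
have CE : (C < E)%N.
  apply/ltP/INR_lt; have := S_INR C; have := Rmult_le_compat_r _ _ _ (Rlt_le _ _ E2) e1; lra.
(* Chosen so that ln (2 E) <= (e/2) ln n, which absorbs the loss in n <= 2 E Q. *)
have [N HN] := INR_unbounded (exp (Rmult (Rdiv 2 e) (ln (Rmult 2 (INR E))))).
exists (maxn N E) => n; rewrite geq_max => /andP[Nn En].
exists (n %/ E); set Q := n %/ E.
have E0 : 0 < E by apply: leq_ltn_trans CE.
have QE : Q * E <= n by apply: leq_divM.
have nQE : n < Q.+1 * E by apply: ltn_ceil.
have Q0 : 0 < Q by rewrite divn_gt0.
have CQn : C * Q <= n by apply: leq_trans QE; rewrite mulnC leq_mul2l ltnW ?orbT.
split=> //; rewrite -expnM INR_expn.
have Q1 : Rle 1 (INR Q) by apply: (le_INR 1); apply/leP.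
have n1 : Rle 1 (INR n) by apply: (le_INR 1); apply/leP; apply: leq_trans En.
rewrite -Rpower_pow; last lra.
rewrite /Rpower mult_INR minus_INR; last exact/leP.
have nQ : Rle (INR n) (Rmult (INR Q) (Rmult 2 (INR E))).
  have : (n <= Q * (2 * E))%N by apply: ltnW; apply: leq_trans nQE _; rewrite mulnA leq_mul2r; lia.
  by move=> /leP/le_INR; rewrite !mult_INR.
have lnQ : Rle (ln (INR n)) (Rplus (ln (INR Q)) (ln (Rmult 2 (INR E)))).
  rewrite -ln_mult; try lra; apply: ln_le => //; lra.
have lnn : Rle (Rmult (Rdiv 2 e) (ln (Rmult 2 (INR E)))) (ln (INR n)).
  rewrite -[X in Rle X _]ln_exp; apply: ln_le; first exact: exp_pos.
  by have := le_INR _ _ (elimT leP Nn); lra.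
have lnn' : Rle (ln (Rmult 2 (INR E))) (Rmult (Rdiv e 2) (ln (INR n))).
  have := Rmult_le_compat_l (Rdiv e 2) _ _ ltac:(lra) lnn.
  have -> : Rmult (Rdiv e 2) (Rmult (Rdiv 2 e) (ln (Rmult 2 (INR E)))) = ln (Rmult 2 (INR E)) by field; lra.
  by [].
have A0 : Rle 0 (ln (INR n)) by rewrite -ln_1; apply: ln_le; lra.
have CQ : Rle (INR (C * Q)) (Rmult (Rdiv e 2) (INR n)).
  rewrite mult_INR; apply: Rle_trans (_ : Rle _ (Rmult (Rmult (Rdiv e 2) (INR E)) (INR Q))) _.
    by apply: Rmult_le_compat_r; have := S_INR C; lra.
  have := le_INR _ _ (elimT leP QE); rewrite mult_INR => h.
  have := Rmult_le_compat_l (Rdiv e 2) _ _ ltac:(lra) h; lra.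
have exp_le x y : Rle x y -> Rle (exp x) (exp y).
  by case=> [/exp_increasing/Rlt_le//|->]; apply: Rle_refl.
apply: exp_le; set A := ln (INR n) in lnQ lnn lnn' A0 *.
have h1 : Rle (Rmult (Rminus 1 (Rdiv e 2)) A) (ln (INR Q)) by lra.
have h2 : Rle (Rmult (Rminus 1 (Rdiv e 2)) (INR n)) (Rminus (INR n) (INR (C * Q))) by lra.
have h3 := Rmult_le_compat _ _ _ _ _ _ h2 h1.
have {}h3 := h3 ltac:(apply: Rmult_le_pos; lra) ltac:(apply: Rmult_le_pos; lra).
have nA : Rle 0 (Rmult (INR n) A) by apply: Rmult_le_pos; lra.
have h4 : Rle (Rmult (Rminus 1 eps) (Rmult (INR n) A))
  (Rmult (Rminus (INR n) (INR (C * Q))) (ln (INR Q))).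
  apply: Rle_trans h3.
  have -> : Rmult (Rmult (Rminus 1 (Rdiv e 2)) (INR n)) (Rmult (Rminus 1 (Rdiv e 2)) A) =
    Rmult (Rmult (Rminus 1 (Rdiv e 2)) (Rminus 1 (Rdiv e 2))) (Rmult (INR n) A) by field.
  apply: Rmult_le_compat_r => //.
  have : Rle 0 (Rmult e e) by apply: Rmult_le_pos; lra.
  lra.
have := Rmult_le_compat_l _ _ _ (pos_INR d) h4.
move: (ln (INR Q)) (INR (C * Q)) => u v; lra.
Qed.

Theorem theorem1p5 (L : finType) (d k : nat) (P : 'I_k -> mpoly (d + d))
  (phi : {ffun 'I_k -> sign} -> L) (U : point d -> Prop) :
  1 <= d ->
  (exists x, U x) ->
  is_open U ->
  definable_by_polys U ->
  (forall a a' : point d, U a -> U a' -> (exists i, a i <> a' i) ->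
     exists b : point d, U b /\
       (forall s, eval2 (P s) a b <> R0 /\ eval2 (P s) a' b <> R0) /\
       lab P phi a b <> lab P phi a' b) ->
  forall eps : R, Rlt R0 eps ->
  exists N : nat, forall n : nat, N <= n ->
    exists cs : seq (labeling n L),
      uniq cs /\
      (forall c, c \in cs -> strongly_representable P phi U c) /\
      Rle (Rpower (INR n) (Rmult (Rmult (Rminus R1 eps) (INR d)) (INR n))) (INR (size cs)).
Proof.
move=> d0 U0 openU _ sepU eps eps0.
have [C HC] := separating_configuration d0 openU sepU U0.
have [N HN] := counting_bound C d eps0.
exists N => n /HN[Q [CQn bound]]; have [B [x [UB [Ux xB]]]] := HC Q.
have := many_labelings d0 openU sepU (n - C * Q) UB Ux xB.
rewrite subnK // => -[cs [ucs [rcs scs]]].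
by exists cs; rewrite scs.
Qed.
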